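(* Let $k\ge2$ and let $n_1,\ldots,n_k\ge2$ with $n_i\mid n_{i-1}$ for $2\le i\le k$ and $n_1>2$. Then $$\mathrm{BF}_+(\mathsf{X}_{\mathrm{diag}(n_1,\ldots,n_k)})=-\,\mathbb{Z}/m\mathbb{Z}\oplus\mathbb{Z}/n_3\mathbb{Z}\oplus\cdots\oplus\mathbb{Z}/n_k\mathbb{Z}\qquad\text{for } m=n_1n_2\Big(k-1-\sum_{i=1}^k\frac1{n_i}\Big).$$
   Context: For a finite list $L$ of nonempty words, the renewal system $\mathsf{X}(L)$ is the shift space whose language is the set of factors of finite concatenations of words from $L$. The renewal system $\mathsf{X}_{\mathrm{diag}(n_1,\ldots,n_k)}$: let $k\ge2$, let $a_1,\ldots,a_k$ be distinct letters, and let $n_1,\ldots,n_k\ge2$ with $\max_in_i>2$. For $1\le i\le k$ let $$L_i=\{a_ja_i^l\mid j\ne i,\ 0<l<n_i-1\}\cup\{a_ma_ja_i^l\mid m\ne j\neq i,\ 0<l<n_i-1\},$$ and $\mathsf{X}_{\mathrm{diag}(n_1,\ldots,n_k)}=\mathsf{X}(\bigcup_{i=1}^kL_i)$. This is the shift of finite type over $\{a_1,\ldots,a_k\}$ with set of forbidden words $\{a_i^{n_i}\mid 1\le i\le k\}$. Every shift of finite type is conjugate to the edge shift of a finite directed graph with some $n\times n$ adjacency matrix $A$; its Bowen-Franks group is $\mathbb{Z}^n/\mathbb{Z}^n(\mathrm{Id}-A)$ and its determinant is $\det(\mathrm{Id}-A)$, both independent of the choice of $A$. The signed Bowen-Franks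 group $\mathrm{BF}_+$ is the Bowen-Franks group together with the sign of the determinant; $\mathrm{BF}_+=-G$ means the Bowen-Franks group is (isomorphic to) $G$ and the determinant is negative (the sign applies to the whole direct sum).
   Formalization: X_diag is taken as the shift of finite type with forbidden words a_i^{n_i}; for the renewal system X(∪L_i) the claim is stated only if k=2 or all n_i>2, since otherwise the two differ: for (4,2,2) the renewal system has group Z/9, not Z/6⊕Z/2. *)

(* Defs.v *)
From HB Require Import structures.
From mathcomp Require Import all_boot all_order all_algebra.
From mathcomp Require Import boolp classical_sets.

Set Implicit Arguments.
Unset Strict Implicit.
Unset Printing Implicit Defensive.

Import Order.TTheory GRing.Theory Num.Theory.

Local Open Scope classical_set_scope.
Local Open Scope ring_scope.

(* Shift spaces over the alphabet T are sets of bi-infinite sequences.        *)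

Definition subword (T : Type) (x : int -> T) (i : int) (l : nat) : seq T :=
  mkseq (fun j => x (i + j%:Z)) l.

Definition shift_of_language (T : Type) (B : set (seq T)) : set (int -> T) :=
  [set x | forall i l, B (subword x i l)].

Definition shift_of_forbidden (T : Type) (F : set (seq T)) : set (int -> T) :=
  [set x | forall i l, ~ F (subword x i l)].

Definition factors_of_concatenations (T : eqType) (L : set (seq T)) :
    set (seq T) :=
  [set u | exists ws : seq (seq T),
     (forall w, w \in ws -> L w) /\ infix u (flatten ws)].

Definition renewal (T : eqType) (L : set (seq T)) : set (int -> T) :=
  shift_of_language (factors_of_concatenations L).

(* A conjugacy is an invertible sliding block code.  The underlying function  *)
(* is only constrained on X; it has memory a and anticipation b.              *)

Definition sliding_block_code (T U : Type) (X : set (int -> T))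
    (Y : set (int -> U)) (f : (int -> T) -> (int -> U)) : Prop :=
  (forall x, X x -> Y (f x)) /\
  exists (a b : nat) (Phi : seq T -> U), forall x, X x -> forall i : int,
    f x i = Phi (subword x (i - a%:Z) (a + b).+1).

Definition conjugate (T U : Type) (X : set (int -> T)) (Y : set (int -> U)) :
    Prop :=
  exists (f : (int -> T) -> (int -> U)) (g : (int -> U) -> (int -> T)),
    [/\ sliding_block_code X Y f, sliding_block_code Y X g,
        forall x, X x -> g (f x) = x & forall y, Y y -> f (g y) = y].

(* The directed graph with adjacency matrix A has A i j edges from i to j.    *)

Definition edge (N : nat) (A : 'M[nat]_N) : finType :=
  {p : 'I_N * 'I_N & 'I_(A p.1 p.2)}.

Definition source (N : nat) (A : 'M[nat]_N) (e : edge A) : 'I_N := (tag e).1.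

Definition target (N : nat) (A : 'M[nat]_N) (e : edge A) : 'I_N := (tag e).2.

Definition edge_shift (N : nat) (A : 'M[nat]_N) : set (int -> edge A) :=
  [set x | forall i : int, target (x i) = source (x (i + 1))].

Arguments edge_shift {N} A _.

Definition row_lattice (N : nat) (M : 'M[int]_N) : {pred 'rV[int]_N} :=
  fun v => `[< exists w : 'rV[int]_N, v = w *m M >].

Fact row_lattice_zmod_closed (N : nat) (M : 'M[int]_N) :
  zmod_closed (row_lattice M).
Proof.
split; first by apply/asboolP; exists 0; rewrite mul0mx.
move=> u v /asboolP[a ->] /asboolP[b ->].
by apply/asboolP; exists (a - b); rewrite mulmxBl.
Qed.

HB.instance Definition _ (N : nat) (M : 'M[int]_N) :=
  GRing.isZmodClosed.Build 'rV[int]_N (row_lattice M)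
    (row_lattice_zmod_closed M).

Definition id_minus (N : nat) (A : 'M[nat]_N) : 'M[int]_N :=
  1%:M - map_mx Posz A.

(* {ideal_quot I} only needs I to be a subgroup of an abelian group.          *)
Definition bowen_franks (N : nat) (A : 'M[nat]_N) : zmodType :=
  {ideal_quot (row_lattice (id_minus A))}.

Definition Zmod (d : nat) : zmodType := {ideal_quot (dvdz d : {pred int})}.

(* Z/d_1 + ... + Z/d_r for ds = [:: d_1; ...; d_r] (the zero group if r = 0)  *)
Fixpoint sum_cyclic (ds : seq nat) : zmodType :=
  if ds is d :: ds' then (Zmod d * sum_cyclic ds')%type else 'rV[int]_0.

Definition group_iso (U V : zmodType) : Prop :=
  exists f : {additive U -> V}, bijective f.

(* BF_+(X) = s G, with s = 1, -1 or 0 the sign of the determinant.  This is a *)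
(* relation: the sign and the isomorphism class of the group do not depend on *)
(* the edge shift chosen to present X.                                        *)
Definition BF_plus_is (T : Type) (X : set (int -> T)) (s : int) (G : zmodType) :
    Prop :=
  exists (N : nat) (A : 'M[nat]_N),
    [/\ conjugate X (edge_shift A), group_iso (bowen_franks A) G
      & Num.sg (\det (id_minus A)) = s].

(* The letter a_i is i : 'I_k.                                                *)

Definition diag_words (k : nat) (n : 'I_k -> nat) (i : 'I_k) :
    set (seq 'I_k) :=
  [set w | exists (j : 'I_k) (l : nat),
     [/\ j != i, (0 < l < n i - 1)%N & w = j :: nseq l i]] `|`
  [set w | exists (m j : 'I_k) (l : nat),
     [/\ m != j, j != i, (0 < l < n i - 1)%N & w = m :: j :: nseq l i]].

Definition Xdiag_renewal (k : nat) (n : 'I_k -> nat) : set (int -> 'I_k) :=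
  renewal [set w | exists i, diag_words n i w].

(* Xdiag_renewal n and Xdiag n are the same shift space if all n_i > 2, and   *)
(* also if k = 2 and max n_i > 2.  They differ if k > 2 and some n_i = 2: for *)
(* (n_1, n_2, n_3) = (4, 2, 2) every generating word ends in a_1, so that     *)
(* a_2 a_3 a_2 is not in the language of Xdiag_renewal n.                     *)
Definition Xdiag (k : nat) (n : 'I_k -> nat) : set (int -> 'I_k) :=
  shift_of_forbidden [set w | exists i, w = nseq (n i) i].

(* Main.v *)
(* Let A be the graph whose states (i, l) record the current letter a_i and   *)
(* the age l of its run; its edge shift is conjugate to Xdiag.  In the        *)
(* cokernel of 1 - A, the class of (i, l) is (n_i - 1 - l) Y_i with           *)
(*   n_1 Y_1 = ... = n_k Y_k = S   and   Y_1 + ... + Y_k = (k - 1) S.         *)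
(* Put z_i = Y_i - (n_1 / n_i) Y_1.  Then n_i z_i = 0 and                     *)
(* z_2 + ... + z_k = c Y_1 with c = m / n_2; eliminating z_2 leaves the       *)
(* generators Y_1, z_3, ..., z_k of orders m, n_3, ..., n_k.  For the         *)
(* determinant, two Schur complements reduce det (1 - A) to                   *)
(* n_1 ... n_k (1 - sum_i (1 - 1 / n_i)) = - m n_3 ... n_k.                   *)

Require Import Defs.
From HB Require Import structures.
From mathcomp Require Import all_boot all_order all_algebra.
From mathcomp Require Import boolp classical_sets.
From mathcomp Require Import perm ring zify.

Set Implicit Arguments.
Unset Strict Implicit.
Unset Printing Implicit Defensive.

Import Order.TTheory GRing.Theory Num.Theory.

Local Open Scope ring_scope.

(** Recording the current letter and the age of its run recodes [Xdiag] as the paths of a finite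
    graph ([conjugate_Xdiag_run_graph]). A step prolongs the run or starts one of another letter, so
    in the cokernel the class of (i, l) drops by a constant Y_i as the age grows by one; this leaves
    k generators Y_i with the relations displayed above ([relations_solved]). The coordinates of a
    combination of the Y_i along Y_1, z_3, ..., z_k are well defined modulo m, n_3, ..., n_k
    ([relation_coordinate]), vanish only on relations ([relations_kill]) and take all values, whence
    [bowen_franks_run_graph]. The same elimination along runs leaves a k by k determinant, of a
    diagonal matrix minus one of rank one ([det_run_graph]); it is negative because m > 0
    ([sg_det_run_graph]). If k = 2 or all n_i > 2, the renewal system is the same shift
    ([Xdiag_renewalE]): concatenated generators never create a forbidden run, and an allowed word,
    extended on the right, is cut into generators from its right end, up to completing the leftmost
    one. *)

Lemma bijective_of_inj_surj (T U : Type) (f : T -> U) :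
  injective f -> (forall y, exists x, f x = y) -> bijective f.
Proof.
move=> inj_f surj_f; have g y := cid (surj_f y).
exists (fun y => sval (g y)) => [x|y]; last exact: svalP (g y).
exact/inj_f/(svalP (g (f x))).
Qed.

(** * Quotients isomorphic to sums of cyclic groups *)

Lemma quot_pi_eq0 (V : zmodType) (I : zmodClosed V) (x : V) :
  (\pi_{ideal_quot I} x == 0)%qT = (x \in I).
Proof. by rewrite -(raddf0 \pi_({ideal_quot I})%qT) -Quotient.idealrBE subr0. Qed.

(** Coordinates are sequences on all of [nat], so that passing to the tail of [ds] is composition
    with [S]; entries from [size ds] on are ignored. *)
Fixpoint cyclic_class (ds : seq nat) (a : nat -> int) : sum_cyclic ds :=
  match ds return sum_cyclic ds with
  | [::] => 0
  | d :: ds' => ((\pi_(Zmod d) (a 0%N))%qT, cyclic_class ds' (a \o S))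
  end.

Lemma cyclic_classB (ds : seq nat) (a b : nat -> int) :
  cyclic_class ds (fun i => a i - b i) = cyclic_class ds a - cyclic_class ds b.
Proof.
elim: ds a b => [|d ds IH] a b /=; first by rewrite subrr.
by rewrite (IH (a \o S) (b \o S)) raddfB.
Qed.

Lemma cyclic_class_eq0 (ds : seq nat) (a : nat -> int) :
  cyclic_class ds a = 0 <->
  (forall i, (i < size ds)%N -> (nth 0%N ds i %| a i)%Z).
Proof.
elim: ds a => [|d ds IH] a /=; first by [].
split=> [[/eqP + /IH H] [_|i /H //]|H]; first by rewrite quot_pi_eq0.
congr pair; last by apply/IH => i /(H i.+1).
by apply/eqP; rewrite quot_pi_eq0; apply: (H 0%N).
Qed.

Lemma cyclic_class_surj (ds : seq nat) (y : sum_cyclic ds) :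
  exists a, cyclic_class ds a = y.
Proof.
elim: ds y => [|d ds IH] /= y; first by exists (fun=> 0); rewrite [y]thinmx0.
case: y => y1 y2; have [a <-] := IH y2.
by exists (fun i => if i is i'.+1 then a i' else repr y1); rewrite /= reprK.
Qed.

Lemma eq_cyclic_class (ds : seq nat) (a b : nat -> int) :
  (forall i, (i < size ds)%N -> a i = b i) ->
  cyclic_class ds a = cyclic_class ds b.
Proof.
elim: ds a b => //= d ds IH a b eqab.
by rewrite (eqab 0%N) // (IH _ (b \o S)) // => i /(eqab i.+1).
Qed.

(** First isomorphism theorem for the map that reduces the coordinates [a] modulo the entries of
    [ds]. *)
Lemma quot_group_iso_sum_cyclic (V : zmodType) (I : zmodClosed V)
    (ds : seq nat) (a : V -> nat -> int) :
    (forall u v i, a (u - v) i = a u i - a v i) ->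
    (forall v, v \in I <->
       forall i, (i < size ds)%N -> (nth 0%N ds i %| a v i)%Z) ->
    (forall b : nat -> int,
       exists v, forall i, (i < size ds)%N -> a v i = b i) ->
  group_iso {ideal_quot I} (sum_cyclic ds).
Proof.
move=> aB kerE surj_a; pose phi v := cyclic_class ds (a v).
have phiB u v : phi (u - v) = phi u - phi v.
  by rewrite /phi -cyclic_classB; apply: eq_cyclic_class => i _; exact: aB.
have phi0 v : v \in I <-> phi v = 0 by rewrite cyclic_class_eq0; exact: kerE.
pose f (x : {ideal_quot I}) := phi (repr x).
have fpi v : f (\pi v)%qT = phi v.
  apply/eqP; rewrite -subr_eq0 -phiB; apply/eqP/phi0.
  by rewrite Quotient.idealrBE reprK.
have fB : zmod_morphism f.
  move=> x y; rewrite -[x]reprK -[y]reprK -raddfB !fpi; exact: phiB.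
pose F := GRing.isZmodMorphism.Build _ _ f fB.
pose fadd : {additive {ideal_quot I} -> sum_cyclic ds} := HB.pack f F.
exists fadd; apply: bijective_of_inj_surj => [|y].
  apply: raddf_inj => x; rewrite -[x]reprK [fadd _]fpi => /phi0 xI.
  by apply/eqP; rewrite quot_pi_eq0.
have [b <-] := cyclic_class_surj y; have [v av] := surj_a b.
by exists (\pi v)%qT; rewrite [fadd _]fpi; apply: eq_cyclic_class.
Qed.

(** * Two determinant identities *)

(* Both sides are the determinant of the block matrix [T, U; V, 1]. *)
Lemma det_sub_mulmx (R : comNzRingType) (p q : nat) (T : 'M[R]_p)
    (U W : 'M[R]_(p, q)) (V : 'M[R]_(q, p)) :
  T *m W = U -> \det (T - U *m V) = \det T * \det (1%:M - V *m W).
Proof.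
move=> TW; pose B := block_mx T U V 1%:M.
transitivity (\det B).
  transitivity (\det (B *m block_mx 1%:M 0 (- V) 1%:M)).
    rewrite mulmx_block !mulmx1 !mulmx0 !add0r mulmxN mul1mx subrr.
    by rewrite det_ublock det1 mulr1.
  by rewrite det_mulmx det_lblock !det1 !mulr1.
transitivity (\det (B *m block_mx 1%:M (- W) 0 1%:M)).
  by rewrite det_mulmx det_ublock !det1 !mulr1.
rewrite mulmx_block !mulmx1 !mulmx0 !addr0 !mulmxN TW addNr det_lblock.
by rewrite addrC.
Qed.

(** A permutation with a nonzero term never lowers [r] and raises it at each moved index; since it
    preserves the sum of [r], it is the identity. *)
Lemma det_unitriangular (R : comNzRingType) (p : nat) (M : 'M[R]_p)
    (r : 'I_p -> nat) :
    (forall i, M i i = 1) ->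
    (forall i j, i != j -> M i j != 0 -> (r i < r j)%N) ->
  \det M = 1.
Proof.
move=> M1 Mr; rewrite /determinant (bigD1 (1%g : 'S_p)) //= odd_perm1 mul1r.
rewrite big1 ?mul1r ?addr0; last by move=> i _; rewrite perm1 M1.
rewrite [X in _ + X]big1 ?addr0 // => s s1.
have [/existsP[i /eqP Mi0]|] := boolP [exists i, M i (s i) == 0].
  by rewrite (bigD1 i) //= Mi0 mul0r mulr0.
rewrite negb_exists => /forallP Mn0; case/eqP: s1; apply/permP => i.
have le_r j : (r j <= r (s j) ?= iff (s j == j))%N.
  have [->|ne] := eqVneq (s j) j; first by split; rewrite ?eqxx.
  have lt_r : (r j < r (s j))%N by apply: Mr (Mn0 j); rewrite // eq_sym.
  by split; rewrite ?(ltnW lt_r) // ltn_eqF.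
have [_] := leqif_sum (P := xpredT) (fun j _ => le_r j).
rewrite (reindex_inj (@perm_inj _ s)) eqxx => /esym/forall_inP/(_ i isT)/eqP.
by rewrite perm1.
Qed.

(** * Graphs without parallel edges and their edge shifts *)

Definition adjacency (V : finType) (e : rel V) : 'M[nat]_#|V| :=
  \matrix_(i, j) (e (enum_val i) (enum_val j) : nat).

Lemma edge_inj (V : finType) (e : rel V) (a b : edge (adjacency e)) :
  source a = source b -> target a = target b -> a = b.
Proof.
case: a b => [[u v] a] [[u' v'] b]; rewrite /source /target /= => eu ev.
case: u' / eu b; case: v' / ev => b; congr existT; apply: val_inj.
by case: a b => [a +] [b +] /=; rewrite mxE; case: (e _ _); case: a; case: b.
Qed.

Lemma edge_rel (V : finType) (e : rel V) (a : edge (adjacency e)) :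
  e (enum_val (source a)) (enum_val (target a)).
Proof.
by case: a => [[u v] [a +]]; rewrite /source /target /= mxE; case: (e _ _).
Qed.

Lemma edge_exists (V : finType) (e : rel V) (u v : V) :
  e u v -> exists a : edge (adjacency e),
    source a = enum_rank u /\ target a = enum_rank v.
Proof.
move=> euv; have lt0 : (0 < adjacency e (enum_rank u) (enum_rank v))%N.
  by rewrite mxE !enum_rankK euv.
by exists (existT (fun q => 'I_(adjacency e q.1 q.2))
             (enum_rank u, enum_rank v) (Ordinal lt0)).
Qed.

Lemma nth_subword (T : Type) (c : T) (x : int -> T) (i : int) (l t : nat) :
  (t < l)%N -> nth c (subword x i l) t = x (i + t%:Z).
Proof. exact: nth_mkseq. Qed.

Lemma subwordD (T : Type) (x : int -> T) (i : int) (l l' : nat) :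
  subword x i (l + l') = subword x i l ++ subword x (i + l%:Z) l'.
Proof.
rewrite /subword /mkseq iotaD map_cat add0n; congr cat.
rewrite -[X in iota X]addn0 iotaDl -map_comp; apply: eq_map => t /=.
by rewrite PoszD addrA.
Qed.

Lemma size_subword (T : Type) (x : int -> T) (i : int) (l : nat) :
  size (subword x i l) = l.
Proof. exact: size_mkseq. Qed.

(** [s] recodes a point as a path of vertices and [h] reads it back; without parallel edges, a path
    of vertices amounts to a path of edges. The first hypothesis supplies default values. *)
Lemma conjugate_edge_shift (T : Type) (V : finType) (e : rel V)
    (X : set (int -> T)) (a : nat) (Phi : seq T -> V)
    (s : (int -> T) -> int -> V) (h : V -> T) :
    (exists u v, e u v) ->
    (forall x, X x -> forall i, s x i = Phi (subword x (i - a%:Z) a.+1)) ->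
    (forall x, X x -> forall i, e (s x i) (s x (i + 1))) ->
    (forall x, X x -> forall i, h (s x i) = x i) ->
    (forall v, (forall i, e (v i) (v (i + 1))) -> X (h \o v)) ->
    (forall v, (forall i, e (v i) (v (i + 1))) -> s (h \o v) =1 v) ->
  conjugate X (edge_shift (adjacency e)).
Proof.
move=> [u0 [v0 e0]] sPhi s_e hs Xh sh; have [a0 _] := edge_exists e0.
have /choice[mk mk_uncurried] (uv : V * V) : exists b : edge (adjacency e),
    e uv.1 uv.2 -> source b = enum_rank uv.1 /\ target b = enum_rank uv.2.
  case: (boolP (e uv.1 uv.2)) => [/edge_exists[b bP]|_]; first by exists b.
  by exists a0.
have mkP u v : e u v -> source (mk (u, v)) = enum_rank u /\
    target (mk (u, v)) = enum_rank v := mk_uncurried (u, v).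
pose f x i := mk (s x i, s x (i + 1)).
pose g (y : int -> edge (adjacency e)) i := h (enum_val (source (y i))).
have path_of y : edge_shift (adjacency e) y -> forall i,
    e (enum_val (source (y i))) (enum_val (source (y (i + 1)))).
  by move=> yP i; rewrite -yP; exact: edge_rel.
exists f, g; split.
- split=> [x Xx i|].
    have [_ ->] := mkP _ _ (s_e x Xx i).
    by have [-> _] := mkP _ _ (s_e x Xx (i + 1)).
  (* The edge at [i] needs the vertices at [i] and [i + 1], hence anticipation 1 and two overlapping
     windows of length [a.+1]. *)
  exists a, 1%N, (fun w => mk (Phi (take a.+1 w), Phi (behead w))) => x Xx i.
  rewrite /f !sPhi //; congr (mk (Phi _, Phi _)).
    rewrite -addSn subwordD take_size_cat //; exact: size_subword.
  by rewrite addn1 -[a.+2]add1n subwordD /= addrAC.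
- split=> [y yP|]; first exact: (Xh _ (path_of y yP)).
  exists 0%N, 0%N,
    (fun w => if w is b :: _ then h (enum_val (source b)) else h u0).
  by move=> y _ i /=; rewrite subr0 addr0.
- move=> x Xx; apply: functional_extensionality_dep => i.
  by rewrite /g /f; have [-> _] := mkP _ _ (s_e x Xx i); rewrite enum_rankK hs.
- move=> y yP; apply: functional_extensionality_dep => i.
  have sE := sh _ (path_of y yP).
  have eS : e (s (g y) i) (s (g y) (i + 1)) by rewrite !sE; exact: path_of.
  have [fS fT] := mkP _ _ eS.
  by apply: edge_inj; rewrite ?fS ?fT sE enum_valK.
Qed.

Lemma find_iota0 (q : pred nat) (P l : nat) :
  (l < P)%N -> q l -> (forall r, (r < l)%N -> ~~ q r) ->
  find q (iota 0 P) = l.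
Proof.
move=> ltlP ql qlt; have hasq : has q (iota 0 P).
  by apply/hasP; exists l; rewrite ?mem_iota.
have ltf : (find q (iota 0 P) < P)%N by rewrite -{2}(size_iota 0 P) -has_find.
have qf := nth_find 0%N hasq; rewrite nth_iota // add0n in qf.
apply/eqP; rewrite eqn_leq; apply/andP; split; rewrite leqNgt; apply/negP.
  by move=> /(before_find 0%N); rewrite nth_iota // ?(ltn_trans _ ltf) // ql.
by move=> /qlt; rewrite qf.
Qed.

(** * The graph of letters and ages *)

Section RunLengthGraph.

Variables (k p : nat) (n : 'I_k -> nat).
Hypothesis k_gt1 : (1 < k)%N.
Hypothesis n_gt1 : forall i, (1 < n i)%N.
Hypothesis n_le : forall i, (n i <= p.+1)%N.

Definition run_state : finType := ('I_k * 'I_p.+1)%type.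

(* The state (i, l) means that the last l + 1 letters read are a_i and that   *)
(* the letter before them is not.  States with l + 1 >= n_i are isolated.     *)
Definition run_step : rel run_state := fun x y =>
  (x.2.+1 < n x.1)%N &&
  (if y.1 == x.1 then (y.2 == x.2.+1 :> nat) && (y.2.+1 < n x.1)%N
   else y.2 == 0%N :> nat).

(** The search is bounded, so that a finite window determines the age. It returns [p.+1] if no other
    letter is met, which [n_le] excludes on [Xdiag n]. *)
Definition age (x : int -> 'I_k) (i : int) : nat :=
  find (fun r => x (i - r.+1%:Z) != x i) (iota 0 p.+1).

Lemma ageP (x : int -> 'I_k) (i : int) (l : nat) :
  (l <= p)%N -> x (i - l.+1%:Z) != x i ->
  (forall r, (r < l)%N -> x (i - r.+1%:Z) = x i) -> age x i = l.
Proof.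
by move=> lp xl xr; apply: find_iota0 => // r /xr ->; rewrite negbK.
Qed.

Lemma age_before (x : int -> 'I_k) (i : int) (r : nat) :
  (r < age x i)%N -> x (i - r.+1%:Z) = x i.
Proof.
move=> lt_r; have lt_p : (r < p.+1)%N.
  by apply: leq_trans lt_r _; rewrite -[leqRHS](size_iota 0); exact: find_size.
by apply/eqP; have := before_find 0%N lt_r; rewrite nth_iota // => /negbFE.
Qed.

(** Otherwise the [n (x i)] letters ending at [i] form a forbidden run. *)
Lemma age_bound (x : int -> 'I_k) (i : int) :
  Xdiag n x -> ((age x i).+1 < n (x i))%N.
Proof.
move=> Xx; rewrite ltnNge; apply/negP => le_n.
apply: (Xx (i - (n (x i)).-1%:Z) (n (x i))); exists (x i).
apply: (@eq_from_nth _ (x i)); rewrite size_subword ?size_nseq // => t lt_t.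
rewrite nth_subword // nth_nseq lt_t.
have [->|ne_t] := eqVneq t (n (x i)).-1; first by rewrite subrK.
apply: etrans (@age_before x i ((n (x i)).-1 - t).-1 _); last by lia.
by congr x; lia.
Qed.

Lemma age_at (x : int -> 'I_k) (i : int) :
  Xdiag n x -> x (i - (age x i).+1%:Z) != x i.
Proof.
move=> Xx; have lt_p : (age x i < p.+1)%N.
  by apply: leq_trans (n_le (x i)); apply: ltnW; exact: age_bound.
have /(nth_find 0%N) : has (fun r => x (i - r.+1%:Z) != x i) (iota 0 p.+1).
  by rewrite has_find size_iota.
by rewrite -[find _ _]/(age x i) nth_iota.
Qed.

Lemma ageS (x : int -> 'I_k) (i : int) :
  Xdiag n x -> age x (i + 1) = if x (i + 1) == x i then (age x i).+1 else 0%N.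
Proof.
move=> Xx; case: eqVneq => [xi|ne].
  have age_p : ((age x i).+1 <= p)%N.
    by rewrite -ltnS; apply: leq_trans (n_le (x i)); exact: age_bound.
  have shiftE r : i + 1 - r.+2%:Z = i - r.+1%:Z by lia.
  apply: ageP => [//||[_|r lt_r]].
  - by rewrite shiftE xi age_at.
  - by rewrite addrK.
  - by rewrite shiftE xi age_before.
by apply: ageP => //; rewrite addrK eq_sym.
Qed.

(** A state of positive age can only be entered from the same letter at age one less. *)
Lemma run_path_back (v : int -> run_state) (i : int) (r : nat) :
    (forall i, run_step (v i) (v (i + 1))) -> (r <= (v i).2)%N ->
  (v (i - r%:Z)).1 = (v i).1 /\ (v (i - r%:Z)).2 = ((v i).2 - r)%N :> nat.
Proof.
move=> vP; elim: r => [|r IH] le_r; first by rewrite subr0 subn0.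
have [e1 e2] := IH (ltnW le_r); have := vP (i - r.+1%:Z).
have -> : i - r.+1%:Z + 1 = i - r%:Z by lia.
rewrite /run_step e1 e2 => /andP[_]; case: eqVneq => [<-|_]; last first.
  by rewrite subn_eq0 leqNgt le_r.
by case/andP => /eqP le_eq _; rewrite subnS le_eq.
Qed.

Lemma conjugate_Xdiag_run_graph :
  conjugate (Xdiag n) (edge_shift (adjacency run_step)).
Proof.
pose c0 : 'I_k := Ordinal (ltnW k_gt1); pose c1 : 'I_k := Ordinal k_gt1.
pose s x i : run_state := (x i, inord (age x i)).
have sE x i : Xdiag n x -> (s x i).2 = age x i :> nat.
  move=> Xx; rewrite inordK //; apply: leq_trans (n_le (x i)).
  by apply: ltnW; exact: age_bound.
(* The window ends at the current position, so its index [p.+1] is the current letter. *)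
pose Phi w : run_state := (nth c0 w p.+1, inord (find
  (fun r => nth c0 w (p.+1 - r.+1) != nth c0 w p.+1) (iota 0 p.+1))).
have s_comp v : (forall i, run_step (v i) (v (i + 1))) ->
    forall i, age (fst \o v) i = (v i).2.
  move=> vP i; apply: ageP => [|/=|r lt_r /=].
  - by rewrite -ltnS; exact: ltn_ord.
  - have [e1 e2] := run_path_back vP (leqnn (v i).2).
    have := vP (i - (v i).2.+1%:Z).
    have -> : i - (v i).2.+1%:Z + 1 = i - (v i).2%:Z by lia.
    by rewrite /run_step e1 e2 subnn eq_sym; case: eqVneq; rewrite // andbF.
  - by have [] := run_path_back vP lt_r.
apply: (@conjugate_edge_shift _ _ _ _ p.+1 Phi s fst).
- exists (c0, ord0), (c1, ord0); rewrite /run_step /= n_gt1 /=.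
  by case: eqVneq => // /(congr1 val).
- move=> x _ i; rewrite /s /Phi /age nth_subword // subrK; congr (_, inord _).
  apply: eq_in_find => r; rewrite mem_iota => /andP[_ lt_r].
  rewrite nth_subword; last by rewrite ltnS leq_subr.
  by congr (x _ != _); lia.
- move=> x Xx i; rewrite /run_step !sE //= (age_bound i Xx) ageS //=.
  case: eqVneq => [xi|//]; rewrite eqxx /= -xi.
  by have := age_bound (i + 1) Xx; rewrite ageS // xi eqxx.
- by [].
- move=> v vP i l [c cE].
  have lt_n t : (t < n c)%N -> (v (i + t%:Z)).1 = c.
    move=> lt_t; have := nth_nseq c (n c) c t.
    have el : l = n c by rewrite -(size_subword (fst \o v) i l) cE size_nseq.
    by rewrite -cE nth_subword ?el // lt_t => /= ->.
  (* Along [n c] equal letters the age climbs to at least [(n c).-1], and a state that old has no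
     outgoing edge. *)
  have grow t : (t < n c)%N -> (t <= (v (i + t%:Z)%R).2)%N.
    elim: t => // t IH lt_t; have := vP (i + t%:Z).
    have -> : i + t%:Z + 1 = i + t.+1%:Z by lia.
    rewrite /run_step !lt_n // ?(ltnW lt_t) // eqxx => /and3P[_ /eqP -> _].
    by apply: IH; exact: ltnW.
  have n_pos : (0 < n c)%N by exact: ltnW.
  have lt_p : ((n c).-1 < n c)%N by rewrite prednK.
  have := vP (i + (n c).-1%:Z); rewrite /run_step lt_n // => /andP[lt1 _].
  by have := leq_ltn_trans (grow _ lt_p : (_.+1 <= _.+1)%N) lt1;
    rewrite prednK // ltnn.
- by move=> v vP i; rewrite /s s_comp // inord_val -surjective_pairing.
Qed.

End RunLengthGraph.

(** * Cokernel and determinant for the run graph *)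

Section BowenFranks.

Variables (q p c : nat) (n : nat -> nat).
Hypothesis n_gt1 : forall i, (i < q.+2)%N -> (1 < n i)%N.
Hypothesis n_le : forall i, (i < q.+2)%N -> (n i <= p.+1)%N.
Hypothesis n_dvd0 : forall i, (i < q.+2)%N -> (n i %| n 0)%N.
Hypothesis n_dvd1 : forall i, (0 < i < q.+2)%N -> (n i %| n 1)%N.
(** This says c = n_0 (k - 1 - sum_i 1 / n_i) with k = q + 2, written as an addition to avoid
    truncated subtraction. *)
Hypothesis c_def : (\sum_(i < q.+2) n 0 %/ n i + c = n 0 * q.+1)%N.

Let ns (i : 'I_q.+2) : nat := n i.
Let step := run_step (p := p) ns.
Let V := run_state q.+2 p.
(* n 1 * c is the number m of the theorem. *)
Let invariants : seq nat := (n 1 * c)%N :: [seq n i | i <- iota 2 q].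

Lemma sum_same_letter (G : nmodType) (F : V -> G) (x : V) :
  \sum_(y | step x y && (y.1 == x.1)) F y =
    if (x.2.+2 < ns x.1)%N then F (x.1, inord x.2.+1) else 0.
Proof.
have n_le' : (ns x.1 <= p.+1)%N by exact: n_le.
case: ifP => lt_x.
  rewrite (big_pred1 (x.1, inord x.2.+1)) // => -[j l].
  rewrite /= xpair_eqE -[l == _]val_eqE /= inordK; last first.
    by apply: leq_trans n_le'; exact: ltnW.
  rewrite /step /run_step /= andbC; case: eqVneq => //= _.
  by case: eqP => [->|]; rewrite ?andbF // lt_x ltnW.
rewrite big_pred0 // => y; rewrite /step /run_step andbC.
case: eqVneq => //= _; case: eqP => [->|]; rewrite ?andbF //= lt_x.
by rewrite andbF.
Qed.

Lemma sum_run_step (G : nmodType) (F : V -> G) (x : V) :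
  \sum_(y | step x y) F y =
    (if (x.2.+2 < ns x.1)%N then F (x.1, inord x.2.+1) else 0) +
    (if (x.2.+1 < ns x.1)%N then \sum_(j | j != x.1) F (j, ord0) else 0).
Proof.
rewrite (bigID (fun y : V => y.1 == x.1)) sum_same_letter /=; congr (_ + _).
case: ifP => lt_x; last by rewrite big_pred0 // => y; rewrite /step /run_step lt_x.
rewrite (reindex_onto (fun j => (j, ord0) : V) fst) /=.
  apply: eq_bigl => j; rewrite /step /run_step /= lt_x !eqxx.
  by case: (j == x.1); rewrite ?andbF.
move=> [j l] /=; rewrite /step /run_step /= => /andP[/andP[_ +] /negbTE ne].
by rewrite ne => /eqP l0; congr pair; apply: val_inj.
Qed.

(** The coefficient of Y_i in the class of [x]. Truncated subtraction gives 0 on isolated states,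
    whose class is 0. *)
Definition weight (x : V) (i : nat) : nat :=
  ((x.1 == i :> nat) * (n i - x.2.+1))%N.

(** Prolonging the run lowers the weight of its own letter by one, and each other letter can start a
    run of weight n_i - 1. The resulting relation does not depend on the age. *)
Lemma sum_step_weight (x : V) (i : nat) : (i < q.+2)%N ->
  (weight x i)%:Z - \sum_(y | step x y) (weight y i)%:Z =
    if (x.2.+1 < n x.1)%N then 1 - ((i != x.1) * n i)%N%:Z else 0.
Proof.
move=> lt_i; have n_le' : (ns x.1 <= p.+1)%N by exact: n_le.
have -> : \sum_(y | step x y) (weight y i)%:Z =
    (if (x.2.+2 < n x.1)%N then ((x.1 == i :> nat) * (n i - x.2.+2))%N else 0%N)%:Z
    + (if (x.2.+1 < n x.1)%N then ((i != x.1) * (n i).-1)%N else 0%N)%:Z.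
  rewrite sum_run_step /ns; congr (_ + _).
    case: ifP => // lt_x; rewrite /weight /= inordK //.
    by apply: leq_trans n_le'; exact: ltnW.
  case: ifP => // _; case: eqVneq => /= [eq_i|ne].
    by rewrite big1 // => j /negbTE; rewrite -val_eqE /weight /= -eq_i => ->.
  rewrite (bigD1 (Ordinal lt_i)) /=; last by rewrite -val_eqE.
  rewrite big1 => [|j /andP[_ /negbTE]]; last first.
    by rewrite -val_eqE /weight /= => ->.
  by rewrite /weight /= eqxx addr0 subn1.
have := n_gt1 lt_i; rewrite /weight.
by case: (eqVneq (x.1 : nat) i) => [<-|ne]; do 2!case: ifP; lia.
Qed.

(* The class of sum_i t_i Y_i in the basis Y_0, z_2, z_3, ... of the header,  *)
(* with letters numbered from 0.                                              *)
Definition coordinate (t : nat -> int) (r : nat) : int :=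
  if r is r'.+1 then t r'.+2 - t 1%N
  else \sum_(i < q.+2) t i * (n 0 %/ n i)%N%:Z + t 1%N * c%:Z.

Lemma coordinateB (t u : nat -> int) (r : nat) :
  coordinate (fun i => t i - u i) r = coordinate t r - coordinate u r.
Proof.
case: r => [|r] /=; last by ring.
rewrite mulrBl opprD addrACA; congr (_ + _); rewrite -sumrB.
by apply: eq_bigr => i _; rewrite mulrBl.
Qed.

Lemma eq_coordinate (t u : nat -> int) (r : nat) :
    (forall i, (i < q.+2)%N -> t i = u i) -> (r <= q)%N ->
  coordinate t r = coordinate u r.
Proof.
move=> eq_tu; case: r => [|r] le_r /=; last by rewrite !eq_tu.
by rewrite (eq_tu 1%N) //; congr (_ + _); apply: eq_bigr => i _; rewrite eq_tu.
Qed.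

Lemma coordinate0 (r : nat) : coordinate (fun=> 0) r = 0.
Proof.
case: r => [|r] /=; last exact: subrr.
by rewrite mul0r addr0 big1 // => i _; rewrite mul0r.
Qed.

Lemma coordinate_sum (I : finType) (w : I -> int) (t : I -> nat -> int) r :
  coordinate (fun i => \sum_x w x * t x i) r = \sum_x w x * coordinate (t x) r.
Proof.
case: r => [|r] /=; last first.
  by rewrite -sumrB; apply: eq_bigr => x _; rewrite mulrBr.
under [RHS]eq_bigr do rewrite mulrDr mulr_sumr mulrA.
rewrite big_split /= -mulr_suml exchange_big /=; congr (_ + _).
by apply: eq_bigr => i _; rewrite mulr_suml; apply: eq_bigr => x _; rewrite mulrA.
Qed.

Lemma nth_invariants (r : nat) : (r < q)%N ->
  nth 0%N invariants r.+1 = n r.+2.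
Proof. by move=> lt_r; rewrite /= (nth_map 0%N) ?size_iota // nth_iota. Qed.

Lemma size_invariants : size invariants = q.+1.
Proof. by rewrite /= size_map size_iota. Qed.

(* By sum_step_weight, these are the coordinates of the rows of 1 - A.        *)
Lemma relation_coordinate (j r : nat) : (j < q.+2)%N -> (r <= q)%N ->
  (nth 0%N invariants r %|
     coordinate (fun i => 1 - ((i != j) * n i)%N%:Z) r)%Z.
Proof.
move=> lt_j; case: r => [_|r lt_r].
  rewrite /coordinate; have -> : \sum_(i < q.+2)
      (1 - ((i != j :> nat) * n i)%N%:Z) * (n 0 %/ n i)%N%:Z = - c%:Z.
    under eq_bigr => i _.
      rewrite mulrBl mul1r -PoszM -mulnA [(n i * _)%N]mulnC divnK ?n_dvd0 //.
      over.
    rewrite sumrB -!(big_morph Posz PoszD (erefl 0)).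
    rewrite [X in _ - Posz X](bigD1 (Ordinal lt_j)) //= eqxx mul0n add0n.
    rewrite [X in _ - Posz X](eq_bigr (fun=> n 0)) => [|i]; last first.
      by rewrite -val_eqE /= => ->; rewrite mul1n.
    rewrite sum_nat_const cardC1 card_ord mulnC.
    by rewrite -c_def (bigD1 (Ordinal lt_j)) //=; lia.
  (* With t_1 = 1 - [1 != j] n_1, the coordinate t_1 c - c is - [1 != j] n_1 c. *)
  apply/dvdzP; exists (- (1 != j)%N%:Z); rewrite !PoszM /=; ring.
rewrite nth_invariants // /coordinate.
have -> : 1 - ((r.+2 != j) * n r.+2)%N%:Z - (1 - ((1 != j)%N * n 1)%N%:Z) =
   (1 != j)%N%:Z * (n 1)%:Z - (r.+2 != j)%N%:Z * (n r.+2)%:Z.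
  by rewrite !PoszM; ring.
apply: rpredB; last exact: dvdz_mull.
by apply: dvdz_mull; apply: n_dvd1.
Qed.

(** Write Y_i = z_i + (n_0 / n_i) Y_0. Since n_i z_i = 0 and n_i divides t_i - t_1 for i >= 2, while
    z_0 = 0, the z-part is t_1 (sum_i z_i) = t_1 c Y_0; what remains is a multiple of n_1 c Y_0 =
    sum_i n_1 z_i = 0. *)
Lemma relations_kill (G : zmodType) (Y : 'I_q.+2 -> G) (S : G) (t : nat -> int) :
    (forall i : 'I_q.+2, Y i *+ n i = S) ->
    \sum_i Y i = S *+ q.+1 ->
    (forall r, (r <= q)%N -> (nth 0%N invariants r %| coordinate t r)%Z) ->
  \sum_(i < q.+2) Y i *~ t i = 0.
Proof.
move=> YS sumY t_dvd; pose z i := Y i - Y ord0 *+ (n 0 %/ n i).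
have zn (i : 'I_q.+2) : z i *+ n i = 0.
  rewrite mulrnBl YS -mulrnA divnK ?n_dvd0 //.
  by rewrite -(YS ord0) subrr.
have z0 : z ord0 = 0 by rewrite /z divnn ltnW ?n_gt1 // subrr.
have sumz : \sum_i z i = Y ord0 *+ c.
  rewrite sumrB sumY -(YS ord0) -mulrnA -c_def mulrnDr -sumrMnr addrAC.
  by rewrite subrr add0r.
have zn1 (i : 'I_q.+2) : z i *+ n 1 = 0.
  have [->|ne] := eqVneq i ord0; first by rewrite z0 mul0rn.
  have /dvdnP[d ->] : (n i %| n 1)%N.
    by apply: n_dvd1; rewrite ltn_ord andbT lt0n.
  by rewrite mulnC mulrnA zn mul0rn.
have Y0m : Y ord0 *+ (n 1 * c) = 0.
  by rewrite mulnC mulrnA -sumz -sumrMnl big1.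
transitivity (Y ord0 *~ coordinate t 0); last first.
  have /dvdzP[d ->] := t_dvd 0%N (leq0n q).
  by rewrite mulrC mulrzA -[_ *~ Posz _]/(_ *+ (n 1 * c)) Y0m mul0rz.
rewrite /coordinate mulrzDr [in RHS]mulrC mulrzA -[_ *~ Posz c]/(_ *+ c) -sumz.
rewrite mulrz_sumr mulrz_suml -big_split /=; apply: eq_bigr => i _.
have -> : z i *~ t 1%N = z i *~ t i; last first.
  by rewrite mulrC mulrzA mulrzBl addrCA subrr addr0.
apply/eqP; rewrite eq_sym -subr_eq0 -mulrzBr; apply/eqP.
case: i => -[|[|r]] lt_r; last first.
- have /dvdzP[d] := t_dvd r.+1 lt_r; rewrite nth_invariants //= => ->.
  by rewrite mulrC mulrzA -[_ *~ Posz _]/(_ *+ n (Ordinal lt_r)) zn mul0rz.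
- by rewrite subrr.
- by rewrite (_ : Ordinal _ = ord0) ?z0 ?mul0rz //; apply: val_inj.
Qed.

(** Y_i is the sum of the classes of the runs that may follow a_i, so E (i, l) = E (i, l + 1) + Y_i,
    solved by descending from the maximal age. At age 0, S - Y_i = (n_i - 1) Y_i; summing S - Y_i
    over i gives the second relation. *)
Lemma relations_solved (G : zmodType) (E : V -> G) :
    (forall x, E x = \sum_(y | step x y) E y) ->
  exists (Y : 'I_q.+2 -> G) (S : G),
    [/\ forall i : 'I_q.+2, Y i *+ n i = S, \sum_i Y i = S *+ q.+1
      & forall x, E x = Y x.1 *+ (n x.1 - x.2.+1)].
Proof.
move=> relE; pose Y i := \sum_(j | j != i) E (j, ord0).
pose S := \sum_j E (j, ord0).
have EY x : E x = Y x.1 *+ (n x.1 - x.2.+1).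
  have [d] := ubnP (n x.1 - x.2.+1); elim: d x => // d IH [i l] /= lt_d.
  rewrite relE sum_run_step /ns /=; have lt_i := ltn_ord i.
  case: ltnP => lt2; last first.
    rewrite add0r; case: ltnP => lt1.
      by have -> : (n i - l.+1 = 1)%N by lia.
    by have -> : (n i - l.+1 = 0)%N by lia.
  have lt_p : (l.+1 < p.+1)%N by apply: leq_trans (n_le lt_i); exact: ltnW.
  rewrite IH /= inordK // ?(ltnW lt2); last by lia.
  by rewrite -mulrSr; congr (_ *+ _); lia.
have ES i : E (i, ord0) = S - Y i by rewrite /S (bigD1 i) //= addrK.
exists Y, S; split=> // [i|].
  have n_i := n_gt1 (ltn_ord i).
  have /eqP := EY (i, ord0); rewrite ES subr_eq -mulrSr /= => /eqP ->.
  by congr (_ *+ _); lia.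
have : S = \sum_i (S - Y i) by rewrite {1}/S; apply: eq_bigr.
rewrite sumrB sumr_const card_ord => /eqP; rewrite eq_sym subr_eq => /eqP H.
by apply: (addrI S); rewrite -H -mulrS.
Qed.

Lemma id_minus_adjacency (U : finType) (e : rel U) (x y : U) :
  id_minus (adjacency e) (enum_rank x) (enum_rank y) =
    (x == y)%:Z - (e x y)%:Z.
Proof.
by rewrite !mxE !enum_rankK (inj_eq enum_rank_inj); case: (x == y).
Qed.

Lemma sum_enum_rank (U : finType) (G : nmodType) (F : 'I_#|U| -> G) :
  \sum_i F i = \sum_x F (enum_rank x).
Proof. by rewrite (reindex (@enum_rank U)) //; exact/onW_bij/enum_rank_bij. Qed.

Lemma sum_id_minus (U : finType) (e : rel U) (F : U -> int) (x : U) :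
  \sum_y id_minus (adjacency e) (enum_rank x) (enum_rank y) * F y =
    F x - \sum_(y | e x y) F y.
Proof.
under eq_bigr do rewrite id_minus_adjacency mulrBl.
rewrite sumrB (bigD1 x) //= eqxx mul1r big1 ?addr0; last first.
  by move=> y /negbTE; rewrite eq_sym => ->; rewrite mul0r.
congr (_ - _); rewrite [RHS]big_mkcond; apply: eq_bigr => y _.
by case: (e x y); rewrite ?mul1r ?mul0r.
Qed.

Lemma pi_relation (U : finType) (e : rel U)
    (E := fun x : U => (\pi_(bowen_franks (adjacency e))
                          (delta_mx 0 (enum_rank x)))%qT) (x : U) :
  E x = \sum_(y | e x y) E y.
Proof.
pose L := row_lattice (id_minus (adjacency e)).
apply/eqP; rewrite -subr_eq0 -raddf_sum -raddfB quot_pi_eq0.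
apply/asboolP; exists (delta_mx 0 (enum_rank x)); rewrite -rowE.
apply/rowP => j; rewrite -[j]enum_valK [RHS]mxE id_minus_adjacency.
set y := enum_val j; rewrite mxE [X in X + _]mxE [X in _ + X]mxE summxE eqxx /=.
rewrite (inj_eq enum_rank_inj) eq_sym; congr (_ - _); first by case: (x == y).
under eq_bigr do rewrite mxE eqxx (inj_eq enum_rank_inj) /=.
rewrite big_mkcond (bigD1 y) //= eqxx big1 ?addr0; first by case: (e x y).
by move=> z /negbTE; rewrite eq_sym => ->; case: (e x z).
Qed.

(** The coefficient of Y_i in the class of [v]. *)
Definition weight_sum (v : 'rV[int]_#|V|) (i : nat) : int :=
  \sum_x v 0 (enum_rank x) * (weight x i)%:Z.

Lemma bowen_franks_run_graph :
  group_iso (bowen_franks (adjacency step)) (sum_cyclic invariants).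
Proof.
apply: (@quot_group_iso_sum_cyclic _ _ _ (fun v => coordinate (weight_sum v))).
- move=> u v r; rewrite -coordinateB; congr (coordinate _ r).
  apply: functional_extensionality_dep => i; rewrite -sumrB.
  by apply: eq_bigr => x _; rewrite !mxE mulrBl.
- move=> v; rewrite size_invariants; split=> [/asboolP[w ->] r le_r|v_dvd].
    rewrite (@eq_coordinate _ (fun i => \sum_x w 0 (enum_rank x) *
      (if (x.2.+1 < n x.1)%N then 1 - ((i != x.1) * n i)%N%:Z else 0))) //.
      rewrite (coordinate_sum _ (fun x i => if _ then _ else _)).
      apply: rpred_sum => x _; apply: dvdz_mull.
      case: (x.2.+1 < n x.1)%N; first by apply: relation_coordinate.
      by rewrite coordinate0 dvdz0.
    move=> i lt_i; rewrite /weight_sum; under eq_bigr do rewrite mxE mulr_suml.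
    rewrite exchange_big /= sum_enum_rank; apply: eq_bigr => x _.
    under eq_bigr do rewrite -mulrA.
    by rewrite -mulr_sumr sum_id_minus sum_step_weight.
  (* Conversely, the class of [v] is the sum of the Y_i with coefficients [weight_sum v i], which
     [relations_kill] annihilates. *)
  have [Y [S [YS sumY EY]]] := relations_solved (pi_relation step).
  have /(relations_kill YS sumY) : forall r, (r <= q)%N ->
      (nth 0%N invariants r %| coordinate (weight_sum v) r)%Z.
    by move=> r le_r; exact: v_dvd.
  move=> tY; apply/idP; rewrite -quot_pi_eq0 (row_sum_delta v) raddf_sum /=.
  apply/eqP; rewrite -[RHS]tY sum_enum_rank.
  under [RHS]eq_bigr do rewrite mulrz_sumr.
  rewrite [RHS]exchange_big /=; apply: eq_bigr => x _.
  rewrite (bigD1 x.1) //= big1 ?addr0 => [|i ne]; last first.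
    rewrite /weight eq_sym; move: ne; rewrite -val_eqE => /negbTE ->.
    by rewrite mulr0 mulr0z.
  rewrite /weight eqxx mul1n mulrC mulrzA -[_ *~ Posz _]/(_ *+ _) -EY.
  by rewrite -[X in X *: _]intz scaler_int raddfMz.
(* A preimage of [b] under [coordinate]: with t_1 = 0 the later coordinates are the t_i themselves,
   and t_0 corrects the coordinate along Y_0. *)
- move=> b; pose T (i : nat) : int := match i with
    | 0%N => b 0%N - \sum_(r < q) b r.+1 * (n 0 %/ n r.+2)%N%:Z
    | 1%N => 0
    | r.+2 => b r.+1
    end.
  (* The oldest allowed state (i, n_i - 2) has weight 1, so placing T_i there makes [weight_sum v]
     equal to [T]. *)
  pose v : 'rV[int]_#|V| := \row_(j < #|V|)
    let x : V := enum_val j in if x.2.+2 == n x.1 then T x.1 else 0.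
  exists v => r; rewrite size_invariants ltnS => le_r.
  rewrite (@eq_coordinate _ T) => [|i lt_i|//].
    case: r le_r => [_|r lt_r] /=; last by rewrite subr0.
    rewrite mul0r addr0 !big_ord_recl /= mul0r add0r divnn (ltnW (n_gt1 _)) //.
    by rewrite mulr1 -addrA addNr addr0.
  have n_i := n_gt1 lt_i; have n_i' := n_le lt_i.
  have lt_p : (n i - 2 < p.+1)%N by lia.
  rewrite /weight_sum (bigD1 (Ordinal lt_i, inord (n i - 2))) //= mxE.
  rewrite enum_rankK /weight /= inordK // eqxx mul1n.
  have -> : (n i - 2).+2 = n i by lia.
  have -> : (n i - (n i - 2).+1 = 1)%N by lia.
  rewrite eqxx mulr1 big1 ?addr0 // => -[j l] ne.
  rewrite mxE enum_rankK /=; case: eqVneq => [l_j|]; last by rewrite mul0r.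
  case: eqVneq => [j_i|]; last by rewrite mulr0.
  case/eqP: ne; congr pair; apply: val_inj => //=.
  by rewrite inordK // -j_i -l_j; lia.
Qed.

(* In 1 - A = T - U F, the matrix T keeps the edges that prolong a run, and    *)
(* U F is made of the edges that start one.                                   *)
Lemma det_run_graph :
  \det (id_minus (adjacency step)) =
    \det (\matrix_(i < q.+2, j < q.+2)
            ((i == j)%:Z - ((j != i) * (n i).-1)%N%:Z)).
Proof.
pose same : rel V := fun x y => step x y && (y.1 == x.1).
pose T := id_minus (adjacency same).
pose U : 'M[int]_(#|V|, q.+2) := \matrix_(i < #|V|, j < q.+2)
  let x : V := enum_val i in ((x.2.+1 < n x.1)%N && (j != x.1))%:Z.
pose F : 'M[int]_(q.+2, #|V|) := \matrix_(j < q.+2, i < #|V|)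
  (enum_val i == (j, ord0) :> V)%:Z.
(* Inverting T sums along the rest of a run, so [W] counts the n_i - 1 - l states from (i, l) to the
   end of its run. *)
pose W : 'M[int]_(#|V|, q.+2) := \matrix_(i < #|V|, j < q.+2)
  let x : V := enum_val i in ((j != x.1) * (n x.1 - x.2.+1))%N%:Z.
have -> : id_minus (adjacency step) = T - U *m F.
  apply/matrixP => i i'; rewrite -[i]enum_valK -[i']enum_valK.
  move: (enum_val i) (enum_val i') => {i i'} x [j l].
  rewrite [RHS]mxE [X in _ + X]mxE [X in _ - X]mxE !id_minus_adjacency.
  under eq_bigr do rewrite !mxE !enum_rankK xpair_eqE /=.
  rewrite (bigD1 j) //= eqxx big1 ?addr0; last first.
    by move=> j' /negbTE; rewrite eq_sym => ->; rewrite mulr0.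
  rewrite -addrA -opprD; congr (_ - _); rewrite /same /step /run_step /ns /=.
  case: (j == x.1); case: (x.2.+1 < n x.1)%N; rewrite ?andbF ?andbT ?mul0r //=.
    by rewrite addr0.
  by rewrite mul1r -val_eqE add0r.
have TW : T *m W = U.
  apply/matrixP => i j; rewrite -[i]enum_valK; move: (enum_val i) => {i} x.
  rewrite mxE sum_enum_rank.
  under eq_bigr do rewrite [W _ _]mxE enum_rankK.
  rewrite sum_id_minus sum_same_letter !mxE enum_rankK /ns /=.
  case: x => [a l] /=.
  have -> : (if (l.+2 < n a)%N
      then ((j != a) * (n a - (inord l.+1 : 'I_p.+1).+1))%N%:Z else 0) = ((j != a) * (n a - l.+2))%N%:Z.
    case: ltnP => [lt2|le2]; last first.
      by rewrite (eqP (le2 : n a - l.+2 == 0)%N) muln0.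
    by rewrite inordK //; apply: leq_trans (n_le (ltn_ord a)); exact: ltnW.
  by case: (j != a); case: ltnP; lia.
rewrite (det_sub_mulmx _ TW) (@det_unitriangular _ _ T (fun i => (enum_val i).2)).
- rewrite mul1r; congr (\det _); apply/matrixP => i j; rewrite !mxE; congr (_ - _).
    by case: (i == j).
  rewrite sum_enum_rank (bigD1 (i, ord0)) //= !mxE enum_rankK eqxx mul1r.
  rewrite big1 ?addr0 /= ?subn1 // => x /negbTE ne.
  by rewrite !mxE enum_rankK ne mul0r.
- move=> i; rewrite -[i]enum_valK id_minus_adjacency eqxx /same /step /run_step.
  by rewrite eqxx eqn_leq ltnn !andbF.
move=> i j; rewrite -[i]enum_valK -[j]enum_valK id_minus_adjacency.
rewrite (inj_eq enum_rank_inj) !enum_rankK => /negbTE ->; rewrite sub0r oppr_eq0.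
suff lt_same : same (enum_val i) (enum_val j) ->
    ((enum_val i).2 < (enum_val j).2)%N.
  by move: lt_same; case: (same _ _) => // lt_same _; exact: lt_same.
rewrite /same /step /run_step; case: ifP => _; rewrite ?andbF //.
by case/andP=> /and3P[_ /eqP -> _].
Qed.

Lemma c_rat :
  c%:R = (n 0)%:R * (q.+1%:R - \sum_(i < q.+2) (n i)%:R^-1) :> rat.
Proof.
have /(congr1 (fun m => m%:R : rat)) := c_def.
rewrite natrD natrM natr_sum mulrBr => <-.
suff -> : \sum_(i < q.+2) (n 0 %/ n i)%:R =
    (n 0)%:R * \sum_(i < q.+2) (n i)%:R^-1 :> rat by rewrite addrC addKr.
rewrite mulr_sumr; apply: eq_bigr => i _.
rewrite -[in RHS](divnK (n_dvd0 (ltn_ord i))) natrM mulfK //.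
by rewrite pnatr_eq0 -lt0n ltnW ?n_gt1.
Qed.

(** The remaining matrix has diagonal 1 = n_i - (n_i - 1) and entries - (n_i - 1) elsewhere: it is D
    minus a matrix of rank one, with D = diag (n_i) invertible over the rationals. The scalar
    factor, times n_0, is -c. *)
Lemma sg_det_run_graph :
  (0 < c)%N -> Num.sg (\det (id_minus (adjacency step))) = -1.
Proof.
move=> c_gt0; rewrite det_run_graph; set K := \matrix_(i, j) _.
apply: ltr0_sg; rewrite -(ltrz0 rat) -det_map_mx.
pose D : 'M[rat]_q.+2 := diag_mx (\row_i (n i)%:R).
pose u : 'cV[rat]_q.+2 := \col_i ((n i)%:R - 1).
pose w : 'cV[rat]_q.+2 := \col_i (((n i)%:R - 1) / (n i)%:R).
have n_gt0 (i : 'I_q.+2) : (0 < n i)%N by apply: ltnW; exact: n_gt1.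
have n_neq0 (i : 'I_q.+2) : (n i)%:R != 0 :> rat by rewrite pnatr_eq0 -lt0n.
have -> : map_mx intr K = D - u *m const_mx 1.
  apply/matrixP => i j; rewrite !mxE big_ord1 !mxE mulr1 rmorphB /=.
  case: (eqVneq i j) => _.
    by rewrite mul0n mulr1n -[LHS]/(1 - 0); ring.
  by rewrite mul1n mulr0n -subn1 -[LHS]/(0 - (n i - 1)%:R) natrB //; ring.
have Dw : D *m w = u.
  rewrite mul_diag_mx; apply/matrixP => i j; rewrite !mxE.
  by rewrite mulrC divfK.
rewrite (det_sub_mulmx _ Dw) det_diag det_mx11 pmulr_rlt0; last first.
  by apply: prodr_gt0 => i _; rewrite mxE ltr0n.
rewrite !mxE /=.
have n0_gt0 : 0 < (n 0)%:R :> rat by rewrite ltr0n (n_gt0 ord0).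
rewrite -(pmulr_rlt0 _ n0_gt0).
suff -> : (n 0)%:R * (1 *+ (0 == 0 :> 'I_1) -
    \sum_j (const_mx 1 : 'M_(1, q.+2)) 0 j * w j 0) = - c%:R :> rat.
  by rewrite oppr_lt0 ltr0n.
under eq_bigr do rewrite !mxE mul1r mulrBl divff // mul1r.
rewrite sumrB sumr_const card_ord eqxx c_rat -[q.+2%:R]natr1 -[true%:R]/1.
by ring.
Qed.

End BowenFranks.

(** * The renewal system and the shift of finite type *)

Section RenewalSystem.

Variables (k : nat) (n : 'I_k -> nat).
Hypothesis n_gt1 : forall i, (1 < n i)%N.

Let L : set (seq 'I_k) := [set w | exists i, diag_words n i w]%classic.

(* Reads a word after a run of r letters c, checking that no run becomes too  *)
(* long.                                                                      *)
Fixpoint short_runs (c : 'I_k) (r : nat) (s : seq 'I_k) : bool :=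
  if s is d :: s' then
    if d == c then short_runs c r.+1 s' else (r < n c)%N && short_runs d 1 s'
  else (r < n c)%N.

Lemma short_runs_lt c r s : short_runs c r s -> (r < n c)%N.
Proof.
elim: s r => //= d s IH r; case: ifP => _; last by case/andP.
by move/IH; apply: ltn_trans.
Qed.

Lemma short_runs_nseq c r l s :
  short_runs c r (nseq l c ++ s) = short_runs c (r + l) s.
Proof. by elim: l r => [|l IH] r /=; rewrite ?addn0 // eqxx IH addnS. Qed.

Lemma short_runs_switch c r i l s : i != c -> (0 < l)%N ->
  short_runs c r (nseq l i ++ s) = (r < n c)%N && short_runs i l s.
Proof.
by case: l => //= l /negbTE -> _; rewrite short_runs_nseq.
Qed.

Lemma short_runs_no_infix c r s i :
  short_runs c r s -> ~~ infix (nseq (n i) i) s.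
Proof.
have n_i := ltnW (n_gt1 i).
elim: s c r => [|d s IH] c r; first by rewrite infixs0 -size_eq0 size_nseq -lt0n.
move=> short; rewrite infix_consl negb_or; apply/andP; split.
  apply/negP => /prefixP[s' def_s]; move: short; rewrite def_s.
  have [->|ne] := eqVneq i c.
    by rewrite short_runs_nseq => /short_runs_lt; rewrite ltnNge leq_addl.
  by rewrite short_runs_switch // => /andP[_ /short_runs_lt]; rewrite ltnn.
by move: short => /=; case: ifP => _; [|case/andP=> _]; exact: IH.
Qed.

(** A generator starts with a single copy of its first letter and ends in a run at least two short
    of n_i, so a run across a junction still stays below the bound. *)
Lemma short_runs_word w c r : L w -> (r.+1 < n c)%N ->
  exists i l, (l.+1 < n i)%N /\
    forall s, short_runs i l s -> short_runs c r (w ++ s).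
Proof.
have short1 c' r' j i l s : j != i -> (0 < l)%N -> (r'.+1 < n c')%N ->
    short_runs i l s -> short_runs c' r' (j :: nseq l i ++ s).
  move=> ji l_gt0 lt_r short /=; case: eqVneq => [jc|_].
    by rewrite short_runs_switch ?lt_r // -jc eq_sym.
  by rewrite short_runs_switch ?n_gt1 1?eq_sym // ltnW.
case=> i [[j [l [ji /andP[l_gt0 lt_l] ->]]]|
          [m [j [l [mj ji /andP[l_gt0 lt_l] ->]]]]] lt_r.
  exists i, l; split=> [|s]; [lia | exact: short1].
exists i, l; split=> [|s short]; first lia.
have short_j : short_runs j 1 (nseq l i ++ s).
  by rewrite short_runs_switch ?n_gt1 1?eq_sym.
exact: (@short1 c r m j 1%N).
Qed.

Lemma short_runs_flatten ws c r : (forall w, w \in ws -> L w) ->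
  (r.+1 < n c)%N -> short_runs c r (flatten ws).
Proof.
elim: ws c r => [|w ws IH] c r wsL lt_r /=; first exact: ltnW.
have [i [l [lt_l]]] := short_runs_word (wsL w (mem_head _ _)) lt_r.
by apply; apply: IH => // w' w'_in; apply: wsL; rewrite inE w'_in orbT.
Qed.

Lemma Xdiag_renewal_sub x : Xdiag_renewal n x -> Xdiag n x.
Proof.
move=> Xx i l [c cE]; have [ws [wsL]] := Xx i l.
rewrite cE; apply/negP/short_runs_no_infix/(@short_runs_flatten ws c 0%N) => //.
Qed.

Hypothesis k_gt1 : (1 < k)%N.
Hypothesis n_gt2 : exists i, (2 < n i)%N.
(** When a_j a_i^l is peeled off, the next generator to the left may have to end in a_m, which
    requires n_m > 2. *)
Hypothesis n_gt2_next : forall m j i,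
  m != j -> j != i -> (2 < n i)%N -> (2 < n m)%N.

(* Words are cut into maximal runs, listed from the right end. *)
Definition word_of_runs (rs : seq ('I_k * nat)) : seq 'I_k :=
  foldr (fun cr s => s ++ nseq cr.2 cr.1) [::] rs.

Fixpoint valid_runs (rs : seq ('I_k * nat)) : bool :=
  if rs is cr :: rs' then
    [&& (0 < cr.2 < n cr.1)%N,
        (if rs' is dr :: _ then dr.1 != cr.1 else true) & valid_runs rs']
  else true.

Lemma other_letter (c : 'I_k) : exists d, d != c.
Proof.
have [->|ne] := eqVneq c (Ordinal k_gt1); last by exists (Ordinal k_gt1); rewrite eq_sym.
by exists (Ordinal (ltnW k_gt1)).
Qed.

Lemma runs_of_word u : (forall c, ~~ infix (nseq (n c) c) u) ->
  exists2 rs, valid_runs rs & word_of_runs rs = u.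
Proof.
elim/last_ind: u => [|u c IH] no_infix; first by exists [::].
have [d|rs rs_valid rsE] := IH.
  apply: contra (no_infix d) => /infix_trans; apply; exact: infix_rcons.
case: rs rs_valid rsE => [|[d r] rs] rs_valid rsE.
  by exists [:: (c, 1%N)]; rewrite /= ?n_gt1 // -rsE.
have [dc|ne] := eqVneq d c; last first.
  exists [:: (c, 1%N), (d, r) & rs]; last by rewrite -rsE /= cats1.
  by move: rs_valid; rewrite /= n_gt1 ne.
subst d; exists ((c, r.+1) :: rs); last first.
  rewrite -rsE /= -[_ :: nseq _ _]/(nseq r.+1 c) -[r.+1]addn1 nseqD.
  by rewrite catA cats1.
move: rs_valid => /= /and3P[_ -> ->]; rewrite !andbT ltnNge.
apply: contra (no_infix c) => le_n; rewrite -rsE -cats1 /= -catA.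
rewrite infix_catl // -[[:: c]]/(nseq 1 c) -nseqD addn1 -(subnKC le_n) nseqD.
exact: prefix_infix.
Qed.

(* Peel off the last word a_j a_i^l; if this would leave behind a full run of *)
(* a_m just before a_j, peel off a_m a_j a_i^l instead.                       *)
Lemma concatenation_of_runs rs i l :
    (2 < n i)%N -> (l.+1 < n i)%N -> valid_runs ((i, l) :: rs) ->
  exists ws z, (forall w, w \in ws -> L w) /\
    flatten ws = z ++ word_of_runs ((i, l) :: rs).
Proof.
have [N] := ubnP (size rs); elim: N rs i l => // N IH rs i l le_N n_i lt_l.
have L1 j : j != i -> (0 < l)%N -> L (j :: nseq l i).
  by move=> ji l_gt0; exists i; left; exists j, l; rewrite l_gt0; split=> //; lia.
have L2 m j : m != j -> j != i -> (0 < l)%N -> L [:: m, j & nseq l i].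
  move=> mj ji l_gt0; exists i; right; exists m, j, l; rewrite l_gt0.
  by split=> //; lia.
have LS ws w : (forall w, w \in ws -> L w) -> L w ->
    forall w', w' \in rcons ws w -> L w'.
  by move=> wsL Lw w'; rewrite mem_rcons inE => /predU1P[->|/wsL].
case: rs le_N => [|[j r] rs] /= le_N.
  rewrite andbT => /andP[l_gt0 _]; have [j ji] := other_letter i.
  exists [:: j :: nseq l i], [:: j]; split=> [w|]; last by rewrite /= cats0.
  by rewrite inE => /eqP ->; exact: L1.
case/and3P=> /andP[l_gt0 _] ji /and3P[/andP[r_gt0 lt_r] rs_j rs_valid].
(* A run of at least two a_j lends one letter to a_j a_i^l and then has length at most n_j - 2, as
   the recursion requires. *)
case: r r_gt0 lt_r => // -[_ n_j|r _ lt_r]; last first.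
  have [|||ws [z [wsL wsE]]] := IH rs j r.+1 le_N => //.
  - exact: leq_ltn_trans lt_r.
  - by rewrite /= rs_j rs_valid ltnW.
  exists (rcons ws (j :: nseq l i)), z; split; first exact: LS (L1 _ _ _).
  rewrite flatten_rcons wsE /= -[j :: j :: _]/(nseq r.+2 j) -[r.+2]addn1.
  by rewrite nseqD -!catA.
case: rs le_N rs_j rs_valid => [|[m t] rs] /= le_N mj.
  move=> _; exists [:: j :: nseq l i], [::]; split=> [w|]; last by rewrite /= cats0.
  by rewrite inE => /eqP ->; exact: L1.
case/and3P=> /andP[t_gt0 lt_t] rs_m rs_valid; have n_m := n_gt2_next mj ji n_i.
have le_N' : (size rs < N)%N by exact: ltnW.
case: (ltnP t.+1 (n m)) => [lt_t1|le_t].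
  have [|ws [z [wsL wsE]]] := IH rs m t le_N' n_m lt_t1.
    by rewrite /= t_gt0 lt_t rs_m rs_valid.
  exists (rcons ws (j :: nseq l i)), z; split; first exact: LS (L1 _ _ _).
  by rewrite flatten_rcons wsE /= -!catA.
(* Here the run of a_m has its maximal length n_m - 1; lending one a_m leaves n_m - 2, which is
   positive. *)
case: t t_gt0 lt_t le_t => // t _ lt_t le_t.
have [||ws [z [wsL wsE]]] := IH rs m t le_N' n_m => //.
  by apply/and3P; split=> //=; apply/andP; split; lia.
exists (rcons ws [:: m, j & nseq l i]), z; split; first exact: LS (L2 _ _ _ _ _).
rewrite flatten_rcons wsE /= -[m :: nseq t m]/(nseq t.+1 m) -[t.+1]addn1.
by rewrite nseqD -!catA.
Qed.

Lemma Xdiag_sub_renewal x : Xdiag n x -> Xdiag_renewal n x.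
Proof.
move=> Xx i l; have [c|rs rs_valid rsE] := @runs_of_word (subword x i l).
  apply/negP => /infixP[s1 [s2 def_u]].
  have def_l : l = (size s1 + (n c + size s2))%N.
    by rewrite -(size_subword x i l) def_u !size_cat size_nseq.
  apply: (Xx (i + (size s1)%:Z) (n c)); exists c.
  move: def_u; rewrite def_l subwordD => /eqP.
  rewrite eqseq_cat ?size_subword // => /andP[_].
  by rewrite subwordD eqseq_cat ?size_subword ?size_nseq // => /andP[/eqP].
rewrite -rsE; case: rs rs_valid {rsE} => [|[c r] rs] rs_valid.
  by exists [::]; split.
(* The word is extended on the right by a letter that can end a generator. If only n_c exceeds 2,
   that letter is c itself, and another letter must separate it from the last run. *)
have [/existsP[d /andP[dc n_d]]|] := boolP [exists d, (d != c) && (2 < n d)%N].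
  have [||ws [z [wsL wsE]]] := @concatenation_of_runs ((c, r) :: rs) d 1 n_d => //.
    by apply/and3P; split; rewrite //= ?n_gt1 1?eq_sym.
  by exists ws; split=> //; rewrite wsE infix_catl // prefix_infix.
rewrite negb_exists => /forallP none; have [e n_e] := n_gt2.
have n_c : (2 < n c)%N.
  have := none e; rewrite n_e andbT negbK => /eqP <-; exact: n_e.
have [d dc] := other_letter c.
have [||ws [z [wsL wsE]]] :=
    @concatenation_of_runs [:: (d, 1%N), (c, r) & rs] c 1 n_c => //.
  by apply/and3P; split; rewrite //= ?n_gt1 // 1?eq_sym dc.
exists ws; split=> //; rewrite wsE infix_catl //= -!catA.
by rewrite catA prefix_infix.
Qed.

Lemma Xdiag_renewalE : Xdiag_renewal n = Xdiag n.
Proof.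
apply/seteqP; split=> x; [exact: Xdiag_renewal_sub | exact: Xdiag_sub_renewal].
Qed.

End RenewalSystem.

(* The letter i : 'I_k stands for a_(i+1), whence n i.+1 below. *)
Theorem proposition5p53 (k : nat) (n : nat -> nat)
    (hk : (2 <= k)%N)
    (hn : forall i : nat, (1 <= i <= k)%N -> (2 <= n i)%N)
    (hdvd : forall i : nat, (2 <= i <= k)%N -> (n i %| n i.-1)%N)
    (hn1 : (2 < n 1)%N) :
  exists m : nat,
    m%:R = (n 1%N)%:R * (n 2%N)%:R
             * (k%:R - 1 - \sum_(1 <= i < k.+1) (n i)%:R^-1) :> rat /\
    let G := sum_cyclic (m :: [seq n i | i <- index_iota 3 k.+1]) in
    BF_plus_is (Xdiag (fun i : 'I_k => n i.+1)) (-1) G /\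
    ((k = 2%N \/ forall i : nat, (1 <= i <= k)%N -> (2 < n i)%N) ->
     BF_plus_is (Xdiag_renewal (fun i : 'I_k => n i.+1)) (-1) G).
Proof.
case: k hk hn hdvd => [|[|q]] // _ hn hdvd.
pose b i := n i.+1; pose p := (n 1).-1.
have b_gt1 i : (i < q.+2)%N -> (1 < b i)%N by move=> lt_i; apply: hn.
have b_dvd i j : (i <= j < q.+2)%N -> (b j %| b i)%N.
  elim: j => [|j IH]; first by rewrite leqn0 => /andP[/eqP ->].
  rewrite leq_eqVlt => /andP[/predU1P[->//|le_ij] lt_j].
  have bS : (b j.+1 %| b j)%N by apply: (hdvd j.+2).
  by apply: dvdn_trans bS (IH _); rewrite -ltnS le_ij ltnW.
have b_dvd0 i : (i < q.+2)%N -> (b i %| b 0)%N by move=> lt_i; exact: b_dvd.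
have b_dvd1 i : (0 < i < q.+2)%N -> (b i %| b 1)%N by exact: b_dvd.
have b_le i : (i < q.+2)%N -> (b i <= p.+1)%N.
  by move=> lt_i; rewrite prednK ?(ltn_trans _ hn1) // dvdn_leq ?b_dvd0 //
    (ltn_trans _ hn1).
(* This gives m > 0: the first quotient is 1, each other one is at most n_1 / 2, and n_1 > 2. *)
have sum_lt : (\sum_(i < q.+2) b 0 %/ b i < b 0 * q.+1)%N.
  rewrite big_ord_recl /= divnn (ltn_trans _ hn1 : 0 < b 0)%N //.
  have le_sum : (\sum_(i < q.+1) b 0 %/ b (lift ord0 i) <=
      \sum_(i < q.+1) b 0 %/ 2)%N.
    by apply: leq_sum => i _; apply: leq_div2l => //; exact: b_gt1 (ltn_ord _).
  apply: leq_ltn_trans (leq_add (leqnn 1) le_sum) _.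
  rewrite sum_nat_const card_ord; have : (2 < b 0)%N by [].
  move: (b 0) => b0 b0_gt2; have half : (b0 %/ 2 + 2 <= b0)%N by lia.
  by nia.
have [c c_def] : exists c, (\sum_(i < q.+2) b 0 %/ b i + c = b 0 * q.+1)%N.
  by exists (b 0 * q.+1 - \sum_(i < q.+2) b 0 %/ b i)%N; rewrite subnKC // ltnW.
have c_gt0 : (0 < c)%N by lia.
exists (b 1 * c)%N; split.
  rewrite natrM (c_rat b_gt1 b_dvd0 c_def) big_add1 big_mkord /= -[q.+2%:R]natr1.
  by rewrite /b; ring.
have BF_Xdiag : BF_plus_is (Xdiag (fun i : 'I_q.+2 => n i.+1)) (-1)
    (sum_cyclic ((b 1 * c)%N :: [seq n i | i <- index_iota 3 q.+3])).
  exists #|run_state q.+2 p|, (adjacency (run_step (fun i : 'I_q.+2 => b i))).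
  split.
  - by apply: conjugate_Xdiag_run_graph => // i; [exact: b_gt1 | exact: b_le].
  - have -> : [seq n i | i <- index_iota 3 q.+3] = [seq b i | i <- iota 2 q].
      by rewrite /index_iota !subSS subn0 -[3%N]/(1 + 2)%N iotaDl -map_comp.
    exact: bowen_franks_run_graph.
  - exact: (sg_det_run_graph b_gt1 b_le b_dvd0 c_def c_gt0).
split=> // k2_or_gt2; rewrite Xdiag_renewalE // => [i||m j i mj ji n_i].
- exact: b_gt1.
- by exists ord0.
case: k2_or_gt2 => [[q0]|gt2]; last by apply: gt2; exact: ltn_ord.
(* With two letters, m != j and j != i force m = i. *)
suff -> : m = i by [].
apply: val_inj => /=; move: mj ji; rewrite -!val_eqE /=.
by have := ltn_ord m; have := ltn_ord j; have := ltn_ord i; lia.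
Qed.
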